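(* Let $F$ be a classical F-structure on $M$, with $(\sqrt{-1})$-eigenbundle $H\subseteq T_cM$ and $0$-eigenbundle $Q_c\subseteq T_cM$. The big-isotropic structure $E=H\oplus ann(H\oplus Q_c)\subseteq T^{big}_cM$ of $F$ is integrable if and only if $$[H,H]\subseteq H,\qquad [H,Q_c]\subseteq H\oplus Q_c,$$ where the bracket is the Lie bracket on $M$.
   Context: $M$ is a $C^\infty$ manifold, $T_cM=TM\otimes\mathbb{C}$, $T^{big}_cM=(TM\oplus T^*M)\otimes\mathbb{C}$ with the metric $g((X,\alpha),(Y,\beta))=\frac12(\alpha(Y)+\beta(X))$ and the Courant bracket $[(X,\alpha),(Y,\beta)]=([X,Y],L_X\beta-L_Y\alpha+\frac12 d(\alpha(Y)-\beta(X)))$. A classical F-structure is a tensor field $F\in End(TM)$ with $F^3+F=0$; it gives a decomposition $T_cM=H\oplus\bar H\oplus Q_c$ into the eigenbundles for $\sqrt{-1},-\sqrt{-1},0$. The generalized F-structure defined by $F$ is the endomorphism $\Phi(X,\alpha)=(FX,-\alpha\circ F)$ of $TM\oplus T^*M$; its $\sqrt{-1}$-eigenbundle is the $g$-isotropic bundle $E=H\oplus ann(H\oplus Q_c)$, where $ann$ denotes the annihilator in $T^*_cM$. $E$ is integrable if $\Gamma(E)$ is closed under the Courant bracket. $[A,B]\subseteq C$ means that brackets of sections of $A$ with sections of $B$ are sections of $C$. *)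

(* Defs.v *)
From HB Require Import structures.
From mathcomp Require Import all_boot all_order all_algebra.
From mathcomp Require Import all_classical all_reals all_analysis.
From mathcomp Require Import complex.
Set Implicit Arguments.
Unset Strict Implicit.
Unset Printing Implicit Defensive.
Import Order.TTheory GRing.Theory Num.Theory.
Import numFieldNormedType.Exports.
Local Open Scope classical_set_scope.
Local Open Scope ring_scope.

(** * Smooth maps between normed spaces *)

(** [C^{k+1}] on an open set [U]: Frechet differentiable on [U], with all
    directional derivatives [x |-> df_x(v)] of class [C^k] on [U]. *)
Fixpoint Ck_on (R : realType) (V W : normedModType R) (k : nat) (U : set V)
    (f : V -> W) : Prop :=
  if k is k'.+1 then
    (forall x, U x -> differentiable f x) /\
    (forall v, Ck_on k' U (fun x => 'd f x v))
  else forall x, U x -> {for x, continuous f}.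

Definition smooth_on (R : realType) (V W : normedModType R) (U : set V)
    (f : V -> W) : Prop :=
  forall k, Ck_on k U f.

(** * Complex matrix-valued functions of real variables *)

Section ComplexValued.
Variable R : realType.

Definition toC (m p : nat) (A : 'M[R]_(m, p)) : 'M[R[i]]_(m, p) :=
  map_mx (real_complex R) A.

Definition reM (m p : nat) (A : 'M[R[i]]_(m, p)) : 'M[R]_(m, p) :=
  map_mx (@complex.Re R) A.

Definition imM (m p : nat) (A : 'M[R[i]]_(m, p)) : 'M[R]_(m, p) :=
  map_mx (@complex.Im R) A.

Definition imagI : R[i] := Complex 0 1.

Definition csmooth_on (n m p : nat) (U : set 'rV[R]_n)
    (f : 'rV[R]_n -> 'M[R[i]]_(m, p)) : Prop :=
  smooth_on U (fun u => reM (f u)) /\ smooth_on U (fun u => imM (f u)).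

(** The matrix of complex partial derivatives: its entry [(a, b)] is the
    derivative of the component [f^b] with respect to the variable [u^a]
    (vectors are rows, as for [jacobian]). *)
Definition cjacobian (n m : nat) (f : 'rV[R]_n -> 'rV[R[i]]_m) (u : 'rV[R]_n) :
    'M[R[i]]_(n, m) :=
  toC (jacobian (fun w => reM (f w)) u) +
  imagI *: toC (jacobian (fun w => imM (f w)) u).

End ComplexValued.

(** * Smooth manifolds, given by an atlas *)

(** [coord i] is a homeomorphism from the open set [dom i] onto the open set
    [img i] of [R^n], with inverse [param i]; the values of [coord i] and of
    [param i] outside these sets are irrelevant. *)
Record smooth_atlas (R : realType) (n : nat) (M : topologicalType) := SmoothAtlas {
  chart : Type;
  dom : chart -> set M;
  coord : chart -> M -> 'rV[R]_n;
  param : chart -> 'rV[R]_n -> M;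
  img := (fun i => coord i @` dom i);
  dom_open : forall i, open (dom i);
  img_open : forall i, open (img i);
  coordK : forall i x, dom i x -> param i (coord i x) = x;
  coord_cts : forall i x, dom i x -> {for x, continuous (coord i)};
  param_cts : forall i u, img i u -> {for u, continuous (param i)};
  dom_cover : forall x, exists i, dom i x;
  transition_smooth : forall i j,
    smooth_on (coord i @` (dom i `&` dom j)) (coord j \o param i)
}.

Section Fields.
Variables (R : realType) (n : nat) (M : topologicalType).
Variable A : smooth_atlas R n M.

(** [d x_j / d x_i] at the point [x] for the charts [i] and [j]. *)
Definition transition_jac (i j : chart A) (x : M) : 'M[R]_n :=
  jacobian (coord j \o param i) (coord i x).

(** Tensor fields are given by their components in every chart of the atlas,
    subject to the transformation rule on overlaps.  Components of vectors are
    rows, components of covectors are columns, so that [alpha(X)] is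
    [X *m alpha].  Only values at points of the domain of the chart matter. *)

(** Smooth sections of [T_c M]. *)
Record cvector_field := CVectorField {
  vcomp :> chart A -> M -> 'rV[R[i]]_n;
  vcomp_change : forall i j x, dom i x -> dom j x ->
    vcomp j x = vcomp i x *m toC (transition_jac i j x);
  vcomp_smooth : forall i, csmooth_on (img i) (vcomp i \o param i)
}.

(** Smooth sections of [T^*_c M]. *)
Record cone_form := COneForm {
  fcomp :> chart A -> M -> 'cV[R[i]]_n;
  fcomp_change : forall i j x, dom i x -> dom j x ->
    fcomp i x = toC (transition_jac i j x) *m fcomp j x;
  fcomp_smooth : forall i, csmooth_on (img i) (fcomp i \o param i)
}.

(** Classical F-structures.  The endomorphism acts on the row of components of
    a tangent vector by right multiplication: [F X] has components [X *m F]. *)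
Record F_structure := FStructure {
  Fcomp :> chart A -> M -> 'M[R]_n;
  Fcomp_change : forall i j x, dom i x -> dom j x ->
    Fcomp i x *m transition_jac i j x = transition_jac i j x *m Fcomp j x;
  Fcomp_smooth : forall i, smooth_on (img i) (Fcomp i \o param i);
  Fcomp_cubic : forall i x, dom i x ->
    Fcomp i x *m Fcomp i x *m Fcomp i x + Fcomp i x = 0
}.

(** ** Subbundles of [T_c M]: the fibre is the row space of a matrix *)

Definition subbundle := chart A -> M -> 'M[R[i]]_n.

Definition section_of (B : subbundle) (X : cvector_field) : Prop :=
  forall i x, dom i x -> (X i x <= B i x)%MS.

Definition eigenbundle (F : F_structure) (a : R[i]) : subbundle :=
  fun i x => eigenspace (toC (F i x)) a.

Definition bundleH (F : F_structure) : subbundle := eigenbundle F (imagI R).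

Definition bundleQ (F : F_structure) : subbundle := eigenbundle F 0.

Definition bundle_sum (B C : subbundle) : subbundle :=
  fun i x => (B i x + C i x)%MS.

(** ** Brackets *)

(** [[X, Y]^b = X^a d_a Y^b - Y^a d_a X^b]. *)
Definition lie_bracket (X Y : cvector_field) (i : chart A) (x : M) :
    'rV[R[i]]_n :=
  X i x *m cjacobian (Y i \o param i) (coord i x) -
  Y i x *m cjacobian (X i \o param i) (coord i x).

(** [(L_X beta)_a = X^b d_b beta_a + beta_b d_a X^b]. *)
Definition lie_derivative (X : cvector_field) (beta : cone_form)
    (i : chart A) (x : M) : 'cV[R[i]]_n :=
  (X i x *m cjacobian (fun u => (beta i (param i u))^T) (coord i x))^T +
  cjacobian (X i \o param i) (coord i x) *m beta i x.

(** A complex function is represented by its ['M_1]-valued expression in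
    each chart. *)
Definition contraction (alpha : cone_form) (X : cvector_field)
    (i : chart A) (x : M) : 'M[R[i]]_1 :=
  X i x *m alpha i x.

Definition differential (f : chart A -> M -> 'M[R[i]]_1)
    (i : chart A) (x : M) : 'cV[R[i]]_n :=
  cjacobian (f i \o param i) (coord i x).

Definition courant_bracket (X : cvector_field) (alpha : cone_form)
    (Y : cvector_field) (beta : cone_form) (i : chart A) (x : M) :
    'rV[R[i]]_n * 'cV[R[i]]_n :=
  (lie_bracket X Y i x,
   lie_derivative X beta i x - lie_derivative Y alpha i x +
   2^-1 *: differential
     (fun j y => contraction alpha Y j y - contraction beta X j y) i x).

(** [[B, C] \subseteq D].  The bracket of two smooth fields is a smooth field,
    so that being a section of [D] is a condition on its values. *)
Definition bracket_sub (B C D : subbundle) : Prop :=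
  forall X Y : cvector_field, section_of B X -> section_of C Y ->
  forall i x, dom i x -> (lie_bracket X Y i x <= D i x)%MS.

(** ** Subbundles of [T^big_c M] *)

Definition big_subbundle := chart A -> M -> set ('rV[R[i]]_n * 'cV[R[i]]_n).

Definition big_section_of (E : big_subbundle) (X : cvector_field)
    (alpha : cone_form) : Prop :=
  forall i x, dom i x -> E i x (X i x, alpha i x).

Definition courant_integrable (E : big_subbundle) : Prop :=
  forall (X : cvector_field) (alpha : cone_form)
         (Y : cvector_field) (beta : cone_form),
  big_section_of E X alpha -> big_section_of E Y beta ->
  forall i x, dom i x -> E i x (courant_bracket X alpha Y beta i x).

Definition annihilator (B : subbundle) (i : chart A) (x : M) :
    set 'cV[R[i]]_n :=
  [set a | forall v : 'rV[R[i]]_n, (v <= B i x)%MS -> v *m a = 0].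

Definition big_isotropic_of (F : F_structure) : big_subbundle :=
  fun i x => [set e | (e.1 <= bundleH F i x)%MS /\
    annihilator (bundle_sum (bundleH F) (bundleQ F)) i x e.2].

End Fields.

(* Main.v *)
From Pilot Require Import Defs.
From HB Require Import structures.
From mathcomp Require Import all_boot all_order all_algebra.
From mathcomp Require Import all_classical all_reals all_analysis.
From mathcomp Require Import complex ring.
(* Defs is imported again so that [coord] is the chart, not the coordinates of
   a vector in a basis. *)
Import Pilot.Defs.
Set Implicit Arguments.
Unset Strict Implicit.
Unset Printing Implicit Defensive.
Import Order.TTheory GRing.Theory Num.Theory.
Import numFieldNormedType.Exports.
Local Open Scope classical_set_scope.
Local Open Scope ring_scope.

(**
Write [P = F^2 - iF], which is [-2] times the projection of [T_c M] onto the
conjugate of [H] along [H + Q_c]: the kernel of [P] is [H + Q_c], the forms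
[P^* gamma] are the sections of [ann(H + Q_c)], and similarly [F^2 + iF] and
[F^2 + 1] project, up to a factor, onto [H] and [Q_c].

If [beta] annihilates [Z], then [(L_X beta)(Z) = - beta([X, Z])].  For [X] in
[H] and [beta] in [ann(H + Q_c)], the Courant bracket of [(X, 0)] and
[(0, beta)] is [(0, L_X beta)], so integrability says that [[H, H]] lies in [H]
and that [beta([X, Z]) = 0] for all [Z] in [H + Q_c] and all such [beta].

Sections of [H], [Q_c] and [ann(H + Q_c)] with a prescribed value at a point
exist: on a Hausdorff manifold a vector or a covector extends to a global
smooth field by means of a bump function supported in a chart, and the field is
then composed with one of the quadratic polynomials in [F].
*)

(** * Maps of class $C^k$ between normed spaces *)

(** The first-order expansion at [x] involves only values near [x], so it passes from [f] to [g],
    and the differential is the unique continuous linear map in such an expansion. *)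
Lemma differentiable_near_eq (R : realType) (V W : normedModType R)
    (f g : V -> W) (x : V) :
  (\near x, f x = g x) -> differentiable f x ->
  differentiable g x /\ 'd g x = 'd f x :> (V -> W).
Proof.
move=> fg df.
have fgx : f x = g x := nbhs_singleton fg.
have [cdf /eqaddoP ef] := (diff_locallyP x f).1 df.
have eg : g \o shift x = cst (g x) + 'd f x +o_ 0 id.
  apply/eqaddoP => e e0; have fe := ef e e0.
  have fg0 : \forall h \near (0 : V), f (h + x) = g (h + x).
    by move: fg; rewrite (near_shift 0) /= subr0.
  by apply: filterS2 fg0 fe => h /= fgh; rewrite !fctE /= fgx fgh.
have dE : 'd g x = 'd f x :> (V -> W) by exact: diff_unique.
by split=> //; apply/diff_locallyP; rewrite dE.
Qed.

Section Ck.
Variable R : realType.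
Implicit Types V W : normedModType R.

(** Since [T] is open, [f] and [g] have the same differential at every point of [T], so the
    induction applies to each directional derivative. This is the gluing principle for functions
    given by different formulas on different open sets. *)
Lemma Ck_on_local V W k (U : set V) (f : V -> W) :
  (forall x, U x -> exists T (g : V -> W),
    [/\ open T, T x, Ck_on k T g & forall y, T y -> f y = g y]) ->
  Ck_on k U f.
Proof.
elim: k U f => [|k IH] U f H /=.
  move=> x /H[T [g [oT Tx /(_ _ Tx) cg fg]]].
  have efg : {near x, g =1 f}.
    by near=> y; rewrite fg//; near: y; exact: open_nbhs_nbhs.
  rewrite /prop_for /continuous_at fg//; apply: cvg_trans cg; exact: near_eq_cvg.
have D x T (g : V -> W) : open T -> T x -> (forall y, T y -> f y = g y) ->
    differentiable g x -> differentiable f x /\ 'd f x = 'd g x :> (V -> W).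
  move=> oT Tx fg; apply: differentiable_near_eq.
  by near=> y; rewrite fg//; near: y; exact: open_nbhs_nbhs.
split=> [x /H[T [g [oT Tx [dg _] fg]]]|v].
  by have [] := D x T g oT Tx fg (dg _ Tx).
apply: IH => x /H[T [g [oT Tx [dg dgk] fg]]].
exists T, (fun x => 'd g x v); split=> //; first exact: dgk.
by move=> y Ty; have [_ ->] := D y T g oT Ty fg (dg _ Ty).
Unshelve. all: by end_near. Qed.

Lemma Ck_on_eq V W k (U : set V) (f g : V -> W) :
  open U -> (forall y, U y -> f y = g y) -> Ck_on k U g -> Ck_on k U f.
Proof. by move=> oU fg gk; apply: Ck_on_local => x Ux; exists U, g. Qed.

Lemma Ck_on_cst V W k (U : set V) (a : W) : Ck_on k U (fun=> a).
Proof.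
elim: k a => [|k IH] a /=; first by move=> x _; exact: cvg_cst.
split=> [x _|v]; first exact: differentiable_cst.
have -> : (fun x => 'd (fun=> a) x v) = (fun=> (0 : W)).
  by apply/funext => x; rewrite -/(cst a) diff_cst.
exact: IH.
Qed.

Lemma Ck_on_id V k (U : set V) : Ck_on k U (@id V).
Proof.
case: k => [|k] /=; first by move=> x _; exact: cvg_id.
split=> [x _|v]; first exact: ex_diff.
have -> : (fun x => 'd (@id V) x v) = (fun=> v) by apply/funext => x; rewrite diff_val.
exact: Ck_on_cst.
Qed.

Lemma Ck_onW V W k (U : set V) (f : V -> W) : Ck_on k.+1 U f -> Ck_on k U f.
Proof.
elim: k f => [|k IH] f; first by move=> [h _] x /h /differentiable_continuous.
by move=> [h1 h2]; split=> // v; exact: IH.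
Qed.

Lemma Ck_onD V W k (U : set V) (f g : V -> W) : open U ->
  Ck_on k U f -> Ck_on k U g -> Ck_on k U (fun x => f x + g x).
Proof.
move=> oU; elim: k f g => [|k IH] f g /=.
  by move=> hf hg x Ux; apply: cvgD; [exact: hf|exact: hg].
move=> [hf hf'] [hg hg']; split=> [x Ux|v].
  by apply: differentiableD; [exact: hf|exact: hg].
apply: Ck_on_eq (IH _ _ (hf' v) (hg' v)) => // y Uy.
by rewrite (diffD (hf _ Uy) (hg _ Uy)).
Qed.

Lemma Ck_on_sum V W k (U : set V) (I : Type) (r : seq I) (f : I -> V -> W) :
  open U -> (forall i, Ck_on k U (f i)) ->
  Ck_on k U (fun x => \sum_(i <- r) f i x).
Proof.
move=> oU hf; elim: r => [|i r IH].
  by under eq_fun do rewrite big_nil; exact: Ck_on_cst.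
by under eq_fun do rewrite big_cons; exact: Ck_onD.
Qed.

(** A continuous linear map is its own differential, so the derivative of [L (f x)] along [v] is [L]
    applied to that of [f], and the induction closes. *)
Lemma Ck_on_linear V W (W' : normedModType R) k (U : set V)
    (L : {linear W -> W'}) (f : V -> W) :
  open U -> continuous L -> Ck_on k U f -> Ck_on k U (fun x => L (f x)).
Proof.
move=> oU cL; elim: k f => [|k IH] f /=.
  by move=> hf x Ux; apply: continuous_comp; [exact: hf|exact: cL].
move=> [hf hf']; split=> [x Ux|v].
  by apply: differentiable_comp; [exact: hf|exact: linear_differentiable].
apply: Ck_on_eq (IH _ (hf' v)) => // y Uy.
by rewrite diff_comp ?diff_lin//; [exact: hf|exact: linear_differentiable].
Qed.

Lemma Ck_onN V W k (U : set V) (f : V -> W) :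
  open U -> Ck_on k U f -> Ck_on k U (fun x => - f x).
Proof. by move=> oU; apply: (Ck_on_linear (L := -%R)) => //; exact: opp_continuous. Qed.

Lemma diff_bilinear_comp V (W1 W2 W3 : normedModType R)
    (b : {bilinear W1 -> W2 -> W3}) (f : V -> W1) (g : V -> W2) (x : V) :
  continuous (fun p : W1 * W2 => b p.1 p.2) ->
  differentiable f x -> differentiable g x ->
  differentiable (fun y => b (f y) (g y)) x /\
  forall v, 'd (fun y => b (f y) (g y)) x v =
    b (f x) ('d g x v) + b ('d f x v) (g x).
Proof.
move=> cb df dg.
have dp := differentiable_pair df dg.
have db := differentiable_bilin (f x, g x) cb.
have -> : (fun y => b (f y) (g y)) =
  (fun p : W1 * W2 => b p.1 p.2) \o (fun y => (f y, g y)) by [].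
split=> [|v]; first exact: differentiable_comp.
by rewrite (diff_comp dp db) (diff_bilin _ cb) diff_pair.
Qed.

(** By the Leibniz rule the derivative is a sum of two values of the same [b], each on one of the
    maps and a derivative of the other. Scaling and matrix products are both instances. *)
Lemma Ck_on_bilinear V (W1 W2 W3 : normedModType R) k (U : set V)
    (b : {bilinear W1 -> W2 -> W3}) (f : V -> W1) (g : V -> W2) :
  open U -> continuous (fun p : W1 * W2 => b p.1 p.2) ->
  Ck_on k U f -> Ck_on k U g -> Ck_on k U (fun x => b (f x) (g x)).
Proof.
move=> oU cb; elim: k f g => [|k IH] f g.
  move=> hf hg x Ux.
  apply: (@continuous_comp _ _ _ (fun y => (f y, g y)) (fun p => b p.1 p.2)).
    by apply: cvg_pair; [exact: hf|exact: hg].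
  exact: cb.
move=> fk gk; have [hf hf'] := fk; have [hg hg'] := gk; split=> [x Ux|v].
  by have [] := diff_bilinear_comp cb (hf _ Ux) (hg _ Ux).
have H : Ck_on k U (fun x => b (f x) ('d g x v) + b ('d f x v) (g x)).
  by apply: Ck_onD => //; apply: IH => //;
    [exact: Ck_onW fk | exact: hg' | exact: hf' | exact: Ck_onW gk].
apply: Ck_on_eq H => // y Uy.
by have [_ ->] := diff_bilinear_comp cb (hf _ Uy) (hg _ Uy).
Qed.

End Ck.

(** * Matrix-valued maps, composition and Jacobians *)

Section Matrix.
Variable R : realType.

(** A neighbourhood of a matrix contains a product of neighbourhoods of its finitely many entries,
    and a filter is stable under finite intersections. *)
Lemma cvg_mx (T : Type) (F : set_system T) (FF : Filter F) m n
    (f : T -> 'M[R]_(m, n)) (l : 'M[R]_(m, n)) :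
  (forall i j, f x i j @[x --> F] --> l i j) -> f x @[x --> F] --> l.
Proof.
move=> H S [P nP PS].
have {}H i j : \forall x \near F, P i j (f x i j) := H i j _ (nP i j).
suff : \forall x \near F, forall ij : 'I_m * 'I_n, P ij.1 ij.2 (f x ij.1 ij.2).
  by apply: filterS => x hx; apply: PS => i j; exact: hx (i, j).
by apply: filter_forall => -[i j]; exact: H.
Qed.

Lemma mulmx_continuous m n p :
  continuous (fun q : 'M[R]_(m, n) * 'M[R]_(n, p) => q.1 *m q.2).
Proof.
move=> [A B]; apply: cvg_mx => i j.
under eq_fun do rewrite mxE; rewrite mxE /=.
apply: cvg_big => [|k _]; first exact: add_continuous.
apply: cvgM.
  apply: (@cvg_comp _ _ _ fst (fun M : 'M[R]_(m, n) => M i k) _ (nbhs A) _ cvg_fst).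
  exact: coord_continuous.
apply: (@cvg_comp _ _ _ snd (fun M : 'M[R]_(n, p) => M k j) _ (nbhs B) _ cvg_snd).
exact: coord_continuous.
Qed.

End Matrix.

Section CkMatrix.
Variable R : realType.

Lemma scaler_is_bilinear (W : normedModType R) :
  bilinear_for (GRing.Scale.Law.clone _ _ *:%R _) (GRing.Scale.Law.clone _ _ *:%R _)
    (@GRing.scale R W : R -> W -> W).
Proof.
split=> [w|r] a x y /=; first by rewrite scalerDl scalerA.
by rewrite scalerDr !scalerA mulrC.
Qed.

HB.instance Definition _ (W : normedModType R) :=
  bilinear_isBilinear.Build R R W W _ _ (@GRing.scale R W : R -> W -> W)
    (@scaler_is_bilinear W).

Lemma Ck_on_mulmx (V : normedModType R) k (U : set V) m n p
    (f : V -> 'M[R]_(m, n)) (g : V -> 'M[R]_(n, p)) :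
  open U -> Ck_on k U f -> Ck_on k U g -> Ck_on k U (fun x => f x *m g x).
Proof. by move=> oU; apply: Ck_on_bilinear => //; exact: mulmx_continuous. Qed.

Lemma Ck_on_coord (V : normedModType R) k (U : set V) m n
    (f : V -> 'M[R]_(m, n)) i j :
  open U -> Ck_on k U f -> Ck_on k U (fun x => f x i j).
Proof.
move=> oU fk; pose L (A : 'M[R]_(m, n)) : R := A i j.
have lL : linear L by move=> a A B; rewrite /L !mxE.
pose LL : {linear 'M[R]_(m, n) -> R} := HB.pack L (GRing.isLinear.Build _ _ _ _ _ lL).
exact: (@Ck_on_linear _ _ _ _ _ _ LL f oU (@coord_continuous _ _ _ _ _)).
Qed.

Lemma Ck_on_mx (V : normedModType R) k (U : set V) m n (f : V -> 'M[R]_(m, n)) :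
  open U -> (forall i j, Ck_on k U (fun x => f x i j)) -> Ck_on k U f.
Proof.
move=> oU fk.
have H : Ck_on k U (fun x => \sum_i \sum_j f x i j *: delta_mx i j : 'M[R]_(m, n)).
  apply: Ck_on_sum => // i; apply: Ck_on_sum => // j.
  apply: Ck_on_bilinear => //; [exact: scale_continuous|exact: Ck_on_cst].
by apply: Ck_on_eq H => // y _; exact: matrix_sum_delta.
Qed.

Lemma Ck_on_trmx (V : normedModType R) k (U : set V) m n (f : V -> 'M[R]_(m, n)) :
  open U -> Ck_on k U f -> Ck_on k U (fun x => (f x)^T).
Proof.
move=> oU fk; apply: Ck_on_mx => // i j.
by under eq_fun do rewrite mxE; exact: Ck_on_coord.
Qed.

Lemma Ck_on_comp (V W : normedModType R) n k (U : set V) (U' : set 'rV[R]_n)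
    (f : V -> 'rV[R]_n) (g : 'rV[R]_n -> W) :
  open U -> (forall x, U x -> U' (f x)) ->
  Ck_on k U f -> Ck_on k U' g -> Ck_on k U (g \o f).
Proof.
move=> oU sU; elim: k g => [|k IH] g.
  by move=> fk gk x Ux; apply: continuous_comp; [exact: fk|exact/gk/sU].
move=> fk [dg gk]; have [df fk'] := fk; split=> [x Ux|v].
  by apply: differentiable_comp; [exact: df|exact/dg/sU].
(* The chain rule gives ['d g (f x) ('d f x v)], whose direction varies with [x]. Expanding it in
   the standard basis leaves derivatives of [g] in fixed directions, to which the induction
   hypothesis applies. *)
have H : Ck_on k U (fun x => \sum_j ('d f x v) ord0 j *: 'd g (f x) (delta_mx ord0 j)).
  apply: Ck_on_sum => // j; apply: Ck_on_bilinear => //.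
  - exact: scale_continuous.
  - by apply: Ck_on_coord => //; exact: fk'.
  - by apply: (IH (fun u => 'd g u (delta_mx ord0 j))); [exact: Ck_onW|exact: gk].
apply: Ck_on_eq H => // y Uy.
rewrite diff_comp /=; [|exact: df|exact/dg/sU].
rewrite {1}(row_sum_delta ('d f y v)) linear_sum; apply: eq_bigr => j _.
by rewrite linearZ.
Qed.

Lemma smooth_on_jacobian m n (U : set 'rV[R]_m) (f : 'rV[R]_m -> 'rV[R]_n) :
  open U -> smooth_on U f -> smooth_on U (jacobian f).
Proof.
move=> oU sf k; apply: Ck_on_mx => // i j.
have H : Ck_on k U (fun x => 'd f x (delta_mx ord0 i) ord0 j).
  by apply: Ck_on_coord => //; exact: (sf k.+1).2.
by apply: Ck_on_eq H => // y _; rewrite /jacobian mxE.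
Qed.

End CkMatrix.

(** * Smooth bump functions *)

Section Flat.
Variable R : realType.

(* The case [m = 0] is the classical flat function; the family is closed, up to
   linear combinations, under differentiation. *)
Definition flat (m : nat) (s : R) : R :=
  if 0 < s then s^-1 ^+ m * expR (- s^-1) else 0.

Lemma flat_ge0 m s : 0 <= flat m s.
Proof.
rewrite /flat; case: ifP => // s0.
by rewrite mulr_ge0 ?expR_ge0// exprn_ge0// invr_ge0 ltW.
Qed.

(** For positive [s], the exponential of [s^-1] dominates the single term of degree [m.+2] of its
    series. The quadratic bound is what makes the difference quotient at 0 tend to 0. *)
Lemma flat_le m s : flat m s <= (m.+2)`!%:R * s ^+ 2.
Proof.
rewrite /flat; case: ifP => [s0|_]; last by rewrite mulr_ge0 ?ler0n ?sqr_ge0.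
have s'0 : 0 <= s^-1 by rewrite invr_ge0 ltW.
have H : s^-1 ^+ m.+2 / (m.+2)`!%:R <= expR s^-1.
  by apply: le_trans (expR_ge1Dxn m.+1 s'0); rewrite lerDr.
rewrite expRN ler_pdivrMr ?expR_gt0//.
have -> : s^-1 ^+ m = s^-1 ^+ m.+2 * s ^+ 2.
  by rewrite -addn2 exprD -mulrA -exprMn mulVf ?gt_eqF// expr1n mulr1.
rewrite [leRHS]mulrAC ler_wpM2r ?sqr_ge0// mulrC -ler_pdivrMr// ltr0n fact_gt0.
Qed.

Lemma is_derive_flat m (s : R) :
  is_derive s (1 : R) (flat m) (flat m.+2 s - m%:R * flat m.+1 s).
Proof.
have [s0|s0|->] := ltrgt0P s.
- pose g (t : R) := t^-1 ^+ m * expR (- t^-1).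
  have dV : is_derive s (1 : R) (fun t : R => t^-1) (- s ^- 2).
    have := @is_deriveV R id s 1 1; rewrite /= gt_eqF//= => /(_ isT (is_derive_id _ _)).
    by rewrite [_ *: _]mulr1.
  have dE : is_derive s (1 : R) (fun t : R => expR (- t^-1)) (s ^- 2 * expR (- s^-1)).
    have dN := is_deriveN dV.
    have := @is_derive1_comp R expR _ s _ _ (is_derive_expR _) dN.
    rewrite opprK mulrC; exact.
  have dg : is_derive s (1 : R) g (flat m.+2 s - m%:R * flat m.+1 s).
    have -> : g = (fun t : R => t^-1) ^+ m * (fun t : R => expR (- t^-1)).
      by apply/funext => t; rewrite /g /= fctE exprfctE.
    apply: is_derive_eq (is_deriveM (is_deriveX m dV) dE) _.
    rewrite exprfctE.
    rewrite /flat s0 /GRing.scale /= -exprVn.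
    move: (expR _) => E; case: m @g => [|m] _ /=; last move: (m.+1%:R) => c;
      by rewrite !exprS; move: (s^-1) => x; ring.
  apply: near_eq_is_derive dg; near=> t.
  by rewrite /flat /g ifT//; near: t; exact: lt_nbhsr.
- have -> : flat m.+2 s - m%:R * flat m.+1 s = 0.
    by rewrite /flat !ifF ?mulr0 ?subr0// lt_gtF.
  apply: near_eq_is_derive (is_derive_cst 0 s 1); near=> t.
  by rewrite /flat ifF// lt_gtF//; near: t; exact: lt_nbhsl.
- have -> : flat m.+2 0 - m%:R * flat m.+1 0 = 0.
    by rewrite /flat ltxx mulr0 subr0.
  (* At the origin the quotient is at most [(m.+2)]!%:R * [|h|] in absolute value, for [h] of either
     sign. *)
  suff H : (h^-1 *: (flat m (h *: 1 + 0) - flat m 0)) @[h --> (0:R)^'] --> (0 : R).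
    by apply: DeriveDef; [apply/cvg_ex; exists 0|exact/cvg_lim].
  apply/cvgr0Pnorm_lt => e e0; near=> h.
  have h0 : h != 0 by near: h; exact: nbhs_dnbhs_neq.
  rewrite {2}/flat ltxx subr0 addr0 [_ *: 1]mulr1 normrZ normfV.
  rewrite (ger0_norm (flat_ge0 _ _)); apply: (@le_lt_trans _ _ ((m.+2)`!%:R * `|h|)).
    rewrite ler_pdivrMl ?normr_gt0// mulrCA -expr2 -normrX ger0_norm ?sqr_ge0//.
    exact: flat_le.
  rewrite -ltr_pdivlMl ?ltr0n ?fact_gt0//; near: h.
  by apply: dnbhs0_lt; rewrite mulr_gt0// invr_gt0 ltr0n fact_gt0.
Unshelve. all: by end_near. Qed.

Lemma differentiable_flat m (s : R) :
  differentiable (flat m : R -> R) s /\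
  forall v, 'd (flat m : R -> R) s v = v * (flat m.+2 s - m%:R * flat m.+1 s).
Proof.
have [dv dE] := is_derive_flat m s; have df := (derivable1_diffP _ _).1 dv.
split=> // v; rewrite -dE deriveE// -[v in LHS]mulr1.
by rewrite -[v * 1]/(v *: (1 : R)) linearZ.
Qed.

(** The induction on [k] is uniform in [m], because differentiating raises the index by one and by
    two. *)
Lemma Ck_on_flat (V : normedModType R) k (U : set V) m (f : V -> R) :
  open U -> Ck_on k U f -> Ck_on k U (fun x => flat m (f x)).
Proof.
move=> oU; elim: k m => [|k IH] m.
  move=> fk x Ux; apply: (@continuous_comp _ _ _ f (flat m)); first exact: fk.
  exact: differentiable_continuous (differentiable_flat m _).1.
move=> fk; have [df fk'] := fk; split=> [x Ux|v].
  exact: (differentiable_comp (df _ Ux) (differentiable_flat m _).1).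
have H : Ck_on k U (fun x => 'd f x v *:
    (flat m.+2 (f x) + - m%:R *: flat m.+1 (f x))).
  apply: Ck_on_bilinear => //; [exact: scale_continuous|exact: fk'|].
  apply: Ck_onD => //; first by apply: IH; exact: Ck_onW.
  apply: Ck_on_bilinear => //; [exact: scale_continuous|exact: Ck_on_cst|].
  by apply: IH; exact: Ck_onW.
apply: Ck_on_eq H => // y Uy.
rewrite (diff_comp (df _ Uy) (differentiable_flat m _).1) /=.
by rewrite (differentiable_flat m _).2 [in RHS]/GRing.scale /= mulNr.
Qed.

(* Unlike the sup norm carried by ['rV[R]_n], the Euclidean norm used here has
   a smooth square. *)
Definition bump_fun n (c : 'rV[R]_n) (r : R) (u : 'rV[R]_n) : R :=
  flat 0 (r ^+ 2 - ((u - c) *m (u - c)^T) ord0 ord0).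

Lemma smooth_on_bump n (U : set 'rV[R]_n) (c : 'rV[R]_n) r :
  open U -> smooth_on U (bump_fun c r).
Proof.
move=> oU k; apply: Ck_on_flat => //.
have cU : Ck_on k U (fun u : 'rV[R]_n => u - c).
  by apply: Ck_onD => //; [exact: Ck_on_id|exact: Ck_on_cst].
apply: (@Ck_onD _ _ R k U (fun=> r ^+ 2) (fun u => - ((u - c) *m (u - c)^T) ord0 ord0)).
- exact: oU.
- exact: Ck_on_cst.
apply: Ck_onN => //; apply: Ck_on_coord => //; apply: Ck_on_mulmx => //.
exact: Ck_on_trmx.
Qed.

Lemma bump_fun_center n (c : 'rV[R]_n) r : 0 < r -> bump_fun c r c != 0.
Proof.
move=> r0; rewrite /bump_fun subrr mul0mx mxE subr0 /flat exprn_gt0//.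
by rewrite mulf_neq0 ?expr0 ?oner_eq0// gt_eqF ?expR_gt0.
Qed.

(** A nonzero value forces the Euclidean distance to be less than [r], and the sup norm is at most
    the Euclidean one: each squared coordinate is one term of a sum of squares. *)
Lemma bump_fun_support n (c : 'rV[R]_n) r u :
  0 < r -> bump_fun c r u != 0 -> `|u - c| <= r.
Proof.
move=> r0; rewrite /bump_fun /flat; case: ifP => [|_]; last by rewrite eqxx.
rewrite subr_gt0 mxE => H _.
rewrite /Num.Def.normr/= mx_normrE (bigmax_le _ (ltW r0))//= => -[i j] _ /=.
rewrite -ler_sqr ?nnegrE ?(ltW r0)// real_normK ?num_real//.
apply/ltW/(le_lt_trans _ H); rewrite (bigD1 j)//= ord1.
rewrite -[leLHS]addr0 lerD// ?sumr_ge0// => [|l _].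
  by rewrite !mxE expr2.
by rewrite !mxE -expr2 sqr_ge0.
Qed.

End Flat.

(** * Derivatives of complex matrix-valued functions *)

Section ComplexMatrices.
Variable R : realType.

Lemma reM_imM_inj m p (A B : 'M[R[i]]_(m, p)) :
  reM A = reM B -> imM A = imM B -> A = B.
Proof.
move=> /matrixP eR /matrixP eI; apply/matrixP => a b.
have := eR a b; have := eI a b; rewrite !mxE.
by case: (A a b) (B a b) => [x y] [z t] /= -> ->.
Qed.

Lemma reMD m p (A B : 'M[R[i]]_(m, p)) : reM (A + B) = reM A + reM B.
Proof. by apply/matrixP => a b; rewrite !mxE; case: (A a b) (B a b) => [? ?] []. Qed.

Lemma imMD m p (A B : 'M[R[i]]_(m, p)) : imM (A + B) = imM A + imM B.
Proof. by apply/matrixP => a b; rewrite !mxE; case: (A a b) (B a b) => [? ?] []. Qed.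

Lemma reM_mulmx m n p (A : 'M[R[i]]_(m, n)) (B : 'M[R[i]]_(n, p)) :
  reM (A *m B) = reM A *m reM B - imM A *m imM B.
Proof.
apply/matrixP => a b; rewrite !mxE (raddf_sum (@complex.Re R)) -sumrB.
by apply: eq_bigr => c _; rewrite !mxE; case: (A a c) (B c b) => [? ?] [].
Qed.

Lemma imM_mulmx m n p (A : 'M[R[i]]_(m, n)) (B : 'M[R[i]]_(n, p)) :
  imM (A *m B) = reM A *m imM B + imM A *m reM B.
Proof.
apply/matrixP => a b; rewrite !mxE (raddf_sum (@complex.Im R)) -big_split.
by apply: eq_bigr => c _; rewrite !mxE; case: (A a c) (B c b) => [? ?] [].
Qed.

Lemma reM_trmx m p (A : 'M[R[i]]_(m, p)) : reM A^T = (reM A)^T.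
Proof. by apply/matrixP => a b; rewrite !mxE. Qed.

Lemma imM_trmx m p (A : 'M[R[i]]_(m, p)) : imM A^T = (imM A)^T.
Proof. by apply/matrixP => a b; rewrite !mxE. Qed.

Lemma reM_toC m p (A : 'M[R]_(m, p)) : reM (toC A) = A.
Proof. by apply/matrixP => a b; rewrite !mxE. Qed.

Lemma imM_toC m p (A : 'M[R]_(m, p)) : imM (toC A) = 0.
Proof. by apply/matrixP => a b; rewrite !mxE. Qed.

Lemma reM_i m p (A B : 'M[R]_(m, p)) : reM (toC A + imagI R *: toC B) = A.
Proof. by apply/matrixP => a b; rewrite !mxE /=; ring. Qed.

Lemma imM_i m p (A B : 'M[R]_(m, p)) : imM (toC A + imagI R *: toC B) = B.
Proof. by apply/matrixP => a b; rewrite !mxE /=; ring. Qed.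

Lemma csmooth_on_local n m p (U : set 'rV[R]_n) (f : 'rV[R]_n -> 'M[R[i]]_(m, p)) :
  (forall x, U x -> exists T (g : 'rV[R]_n -> 'M[R[i]]_(m, p)),
    [/\ open T, T x, csmooth_on T g & forall y, T y -> f y = g y]) ->
  csmooth_on U f.
Proof.
move=> H; split=> k; apply: Ck_on_local => x /H[T [g [oT Tx [gr gi] fg]]].
- by exists T, (fun u => reM (g u)); split=> // y Ty; rewrite fg.
- by exists T, (fun u => imM (g u)); split=> // y Ty; rewrite fg.
Qed.

Lemma csmooth_on_cst n m p (U : set 'rV[R]_n) (A : 'M[R[i]]_(m, p)) :
  csmooth_on U (fun=> A).
Proof. by split=> k; exact: Ck_on_cst. Qed.

Lemma csmooth_on_toC n m p (U : set 'rV[R]_n) (f : 'rV[R]_n -> 'M[R]_(m, p)) :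
  smooth_on U f -> csmooth_on U (fun u => toC (f u)).
Proof.
move=> sf; split=> k; first by under eq_fun do rewrite reM_toC; exact: sf.
by under eq_fun do rewrite imM_toC; exact: Ck_on_cst.
Qed.

Lemma csmooth_onD n m p (U : set 'rV[R]_n) (f g : 'rV[R]_n -> 'M[R[i]]_(m, p)) :
  open U -> csmooth_on U f -> csmooth_on U g -> csmooth_on U (fun u => f u + g u).
Proof.
move=> oU [fr fi] [gr gi]; split=> k.
  by under eq_fun do rewrite reMD; exact: Ck_onD.
by under eq_fun do rewrite imMD; exact: Ck_onD.
Qed.

Lemma csmooth_on_mulmx n m p q (U : set 'rV[R]_n)
    (f : 'rV[R]_n -> 'M[R[i]]_(m, p)) (g : 'rV[R]_n -> 'M[R[i]]_(p, q)) :
  open U -> csmooth_on U f -> csmooth_on U g -> csmooth_on U (fun u => f u *m g u).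
Proof.
move=> oU [fr fi] [gr gi]; split=> k.
  under eq_fun do rewrite reM_mulmx.
  by apply: Ck_onD => //; last apply: Ck_onN => //; exact: Ck_on_mulmx.
under eq_fun do rewrite imM_mulmx.
by apply: Ck_onD => //; exact: Ck_on_mulmx.
Qed.

Lemma smooth_on_differentiable (V W : normedModType R) (U : set V) (f : V -> W) x :
  smooth_on U f -> U x -> differentiable f x.
Proof. by move=> sf; exact: (sf 1).1. Qed.

Lemma diffDE (V W : normedModType R) (f g : V -> W) x v :
  differentiable f x -> differentiable g x ->
  'd (fun y => f y + g y) x v = 'd f x v + 'd g x v.
Proof. by move=> df dg; rewrite (diffD df dg). Qed.

Lemma diffBE (V W : normedModType R) (f g : V -> W) x v :
  differentiable f x -> differentiable g x ->
  'd (fun y => f y - g y) x v = 'd f x v - 'd g x v.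
Proof. by move=> df dg; rewrite (diffB df dg). Qed.

Lemma diff_mulmx (V : normedModType R) m n p (f : V -> 'M[R]_(m, n))
    (g : V -> 'M[R]_(n, p)) x :
  differentiable f x -> differentiable g x ->
  differentiable (fun y => f y *m g y) x /\
  forall v, 'd (fun y => f y *m g y) x v = f x *m 'd g x v + 'd f x v *m g x.
Proof. exact: (diff_bilinear_comp (@mulmx_continuous R m n p)). Qed.

(** The derivative along a real vector [v], for matrices of any shape. The rows of [cjacobian] are
    its values on the standard basis, so product rules are proved here first. *)
Definition cdiff n m p (f : 'rV[R]_n -> 'M[R[i]]_(m, p)) (u v : 'rV[R]_n) :
    'M[R[i]]_(m, p) :=
  toC ('d (fun w => reM (f w)) u v) + imagI R *: toC ('d (fun w => imM (f w)) u v).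

Lemma reM_cdiff n m p (f : 'rV[R]_n -> 'M[R[i]]_(m, p)) u v :
  reM (cdiff f u v) = 'd (fun w => reM (f w)) u v.
Proof. exact: reM_i. Qed.

Lemma imM_cdiff n m p (f : 'rV[R]_n -> 'M[R[i]]_(m, p)) u v :
  imM (cdiff f u v) = 'd (fun w => imM (f w)) u v.
Proof. exact: imM_i. Qed.

Lemma cdiff_mulmx n m p q (U : set 'rV[R]_n)
    (f : 'rV[R]_n -> 'M[R[i]]_(m, p)) (g : 'rV[R]_n -> 'M[R[i]]_(p, q)) u v :
  csmooth_on U f -> csmooth_on U g -> U u ->
  cdiff (fun w => f w *m g w) u v = f u *m cdiff g u v + cdiff f u v *m g u.
Proof.
move=> [fr fi] [gr gi] Uu.
have {}fr := smooth_on_differentiable fr Uu.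
have {}fi := smooth_on_differentiable fi Uu.
have {}gr := smooth_on_differentiable gr Uu.
have {}gi := smooth_on_differentiable gi Uu.
have [drr drrE] := diff_mulmx fr gr.
have [dii diiE] := diff_mulmx fi gi.
have [dri driE] := diff_mulmx fr gi.
have [dir dirE] := diff_mulmx fi gr.
apply: reM_imM_inj.
- rewrite reM_cdiff reMD !reM_mulmx !reM_cdiff !imM_cdiff.
  rewrite (funext (fun w => reM_mulmx (f w) (g w))).
  rewrite (diffBE v drr dii).
  apply: etrans (congr2 (fun a b => a - b) (drrE v) (diiE v)) _.
  by rewrite opprD addrACA.
- rewrite imM_cdiff imMD !imM_mulmx !reM_cdiff !imM_cdiff.
  rewrite (funext (fun w => imM_mulmx (f w) (g w))).
  rewrite (diffDE v dri dir).
  apply: etrans (congr2 +%R (driE v) (dirE v)) _.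
  by rewrite addrACA.
Qed.

Lemma cdiff_trmx n m p (U : set 'rV[R]_n) (f : 'rV[R]_n -> 'M[R[i]]_(m, p)) u v :
  csmooth_on U f -> U u ->
  cdiff (fun w => (f w)^T) u v = (cdiff f u v)^T.
Proof.
have ctr : continuous (@trmx R m p).
  move=> A; apply: (@cvg_mx _ _ (nbhs A) _) => i j.
  under eq_fun do rewrite mxE; rewrite mxE; exact: coord_continuous.
move=> [/smooth_on_differentiable fr /smooth_on_differentiable fi] Uu.
have dtr A : differentiable (@trmx R m p) A by exact: linear_differentiable.
apply: reM_imM_inj.
- rewrite reM_cdiff reM_trmx reM_cdiff.
  have -> : (fun w => reM (f w)^T) = @trmx R m p \o (fun w => reM (f w)).
    by apply/funext => w; rewrite /= reM_trmx.
  by rewrite diff_comp ?diff_lin//; exact: fr.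
- rewrite imM_cdiff imM_trmx imM_cdiff.
  have -> : (fun w => imM (f w)^T) = @trmx R m p \o (fun w => imM (f w)).
    by apply/funext => w; rewrite /= imM_trmx.
  by rewrite diff_comp ?diff_lin//; exact: fi.
Qed.

Lemma row_cjacobian n m (f : 'rV[R]_n -> 'rV[R[i]]_m) u a :
  row a (cjacobian f u) = cdiff f u (delta_mx ord0 a).
Proof. by apply/rowP => b; rewrite !mxE. Qed.

(** Identities between fields hold only on the image of a chart; since that image is open, they may
    be differentiated there. *)
Lemma cjacobian_eq0 n m (U : set 'rV[R]_n) (f : 'rV[R]_n -> 'rV[R[i]]_m) u :
  open U -> (forall w, U w -> f w = 0) -> U u -> cjacobian f u = 0.
Proof.
move=> oU f0 Uu; apply/row_matrixP => a; rewrite row_cjacobian row0.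
have d0 (h : 'M[R[i]]_(1, m) -> 'rV[R]_m) :
    h 0 = 0 -> 'd (fun w => h (f w)) u = cst 0 :> (_ -> _).
  move=> h0.
  have [_ ->] : differentiable (fun w => h (f w)) u /\
      'd (fun w => h (f w)) u = 'd (cst (0 : 'rV[R]_m)) u :> (_ -> _).
    apply: differentiable_near_eq; last exact: differentiable_cst.
    by near=> w; rewrite f0 ?h0//; near: w; exact: open_nbhs_nbhs.
  by rewrite diff_cst.
apply: reM_imM_inj.
- by rewrite reM_cdiff (d0 (@reM R 1 m)) /reM map_mx0.
- by rewrite imM_cdiff (d0 (@imM R 1 m)) /imM map_mx0.
Unshelve. all: by end_near. Qed.

(** Leibniz rule for a pairing. The transposes turn the column [g] into the row that [cjacobian]
    expects. *)
Lemma cjacobian_mulmx n m (U : set 'rV[R]_n) (f : 'rV[R]_n -> 'rV[R[i]]_m)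
    (g : 'rV[R]_n -> 'cV[R[i]]_m) u :
  csmooth_on U f -> csmooth_on U g -> U u ->
  cjacobian (fun w => f w *m g w) u =
  cjacobian f u *m g u + cjacobian (fun w => (g w)^T) u *m (f u)^T.
Proof.
move=> sf sg Uu; apply/row_matrixP => a.
have rf := row_cjacobian f u a.
have rg : row a (cjacobian (fun w => (g w)^T) u) = (cdiff g u (delta_mx ord0 a))^T.
  by apply: etrans (row_cjacobian _ _ _) (cdiff_trmx _ sg Uu).
apply: etrans (row_cjacobian _ _ _) _.
apply: etrans (cdiff_mulmx _ sf sg Uu) _.
rewrite -rf -[cdiff g u _]trmxK -rg.
move: (cjacobian f u) (cjacobian _ u) => J K.
rewrite linearD /= !row_mul addrC; congr (_ + _).
by apply/matrixP => i j; rewrite !ord1 !mxE; apply: eq_bigr => l _; rewrite !mxE mulrC.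
Qed.

End ComplexMatrices.

(** * Overlaps of charts and Jacobians of the transition maps *)

Lemma jacobianE (R : realType) m n (f : 'rV[R]_m -> 'rV[R]_n) u v :
  v *m jacobian f u = 'd f u v.
Proof. by rewrite /jacobian mul_rV_lin1. Qed.

Section Atlas.
Variables (R : realType) (n : nat) (M : topologicalType).
Variable A : smooth_atlas R n M.
Implicit Types i j k : chart A.

Definition overlap i j : set 'rV[R]_n := coord i @` (dom i `&` dom j).

Lemma img_coord i x : dom i x -> img i (coord i x).
Proof. by move=> ix; exists x. Qed.

Lemma img_param i u : img i u -> dom i (param i u) /\ coord i (param i u) = u.
Proof. by move=> [x ix <-]; rewrite coordK. Qed.

Lemma overlap_param i j u :
  overlap i j u <-> img i u /\ dom j (param i u).
Proof.
split=> [[x [ix jx] <-]|[iu ju]]; first by rewrite coordK//; split; [exact: img_coord|].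
by have [du <-] := img_param iu; exists (param i u).
Qed.

Lemma open_img_preimage i (D : set M) :
  open D -> open [set u | img i u /\ D (param i u)].
Proof.
move=> oD; rewrite openE => u [iu Du].
apply: filterI; first by apply: open_nbhs_nbhs; split; [exact: img_open|].
apply: (param_cts iu); exact: open_nbhs_nbhs.
Qed.

Lemma open_overlap i j : open (overlap i j).
Proof.
have -> : overlap i j = [set u | img i u /\ dom j (param i u)].
  by apply/seteqP; split=> u /overlap_param.
by apply: open_img_preimage; exact: dom_open.
Qed.

Lemma differentiable_transition i j x : dom i x -> dom j x ->
  differentiable (coord j \o param i) (coord i x).
Proof.
move=> ix jx; apply: (smooth_on_differentiable (transition_smooth i j)).
by exists x.
Qed.

Lemma transition_jacE i j x v :
  v *m transition_jac i j x = 'd (coord j \o param i) (coord i x) v.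
Proof. by rewrite /transition_jac jacobianE. Qed.

Lemma transition_jac_id i x : dom i x -> transition_jac i i x = 1%:M.
Proof.
move=> ix; apply/row_matrixP => a; rewrite !rowE mulmx1 transition_jacE.
have [_ ->] : differentiable (coord i \o param i) (coord i x) /\
    'd (coord i \o param i) (coord i x) = 'd id (coord i x) :> (_ -> _).
  apply: differentiable_near_eq; last exact: ex_diff.
  near=> u; rewrite /= (img_param _).2//; near: u.
  by apply: open_nbhs_nbhs; split; [exact: img_open|exact: img_coord].
by rewrite diff_val.
Unshelve. all: by end_near. Qed.

(** Cocycle rule. The transition from [i] to [k] factors through [j] only on [overlap i j], a
    neighbourhood of the point, which is enough for the chain rule. *)
Lemma transition_jac_comp i j k x : dom i x -> dom j x -> dom k x ->
  transition_jac i k x = transition_jac i j x *m transition_jac j k x.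
Proof.
move=> ix jx kx.
have dij := differentiable_transition ix jx.
have cx : (coord j \o param i) (coord i x) = coord j x by rewrite /= coordK.
have djk : differentiable (coord k \o param j) ((coord j \o param i) (coord i x)).
  by rewrite cx; exact: differentiable_transition.
have [_ dE] : differentiable (coord k \o param i) (coord i x) /\
    'd (coord k \o param i) (coord i x) =
    'd ((coord k \o param j) \o (coord j \o param i)) (coord i x) :> (_ -> _).
  apply: differentiable_near_eq; last exact: differentiable_comp.
  near=> u; rewrite /= coordK//.
  suff /overlap_param[] : overlap i j u by [].
  near: u; apply: open_nbhs_nbhs; split; [exact: open_overlap|by exists x].
have E (v : 'rV_n) : v *m transition_jac i k x =
    v *m transition_jac i j x *m transition_jac j k x.
  apply: etrans (transition_jacE i k x v) _.
  apply: etrans (congr1 (fun f => f v) dE) _.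
  apply: etrans (congr1 (fun f => f v) (diff_comp dij djk)) _.
  rewrite cx.
  apply: etrans (congr1 _ (esym (transition_jacE i j x v))) _.
  exact: esym (transition_jacE j k x _).
by apply/row_matrixP => a; rewrite [LHS]rowE [RHS]row_mul [row _ _]rowE.
Unshelve. all: by end_near. Qed.

Lemma smooth_transition_jac i j :
  smooth_on (overlap i j) (transition_jac i j \o param i).
Proof.
move=> k; have oij := open_overlap (i := i) (j := j).
apply: (Ck_on_eq oij _ (smooth_on_jacobian oij (transition_smooth i j) k)) => u.
by move=> /overlap_param[/img_param[_ cu] _]; rewrite /transition_jac /= cu.
Qed.

(** The Jacobian of the transition from [j] to [i] is a function of the coordinates of [j];
    composing with the transition map expresses it in those of [i]. *)
Lemma smooth_transition_jac_inv i j :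
  smooth_on (overlap i j) (transition_jac j i \o param i).
Proof.
move=> k; have oij := open_overlap (i := i) (j := j).
have oji := open_overlap (i := j) (j := i).
apply: (Ck_on_comp (U' := overlap j i) (f := coord j \o param i)) => //.
- move=> u /overlap_param[iu ju]; exists (param i u) => //.
  by split=> //; exact: (img_param iu).1.
- exact: (transition_smooth i j).
- exact: smooth_on_jacobian (transition_smooth j i) k.
Qed.

End Atlas.

(** * Global fields and forms with a prescribed value at a point *)

Section Extension.
Variables (R : realType) (n : nat) (M : topologicalType).
Hypothesis M_hausdorff : hausdorff_space M.
Variable A : smooth_atlas R n M.
Implicit Types i j k : chart A.

Lemma closed_ball_in_img i x : dom i x ->
  exists2 r : R, 0 < r & [set u | `|u - coord i x| <= r] `<=` img i.
Proof.
move=> ix; have oU : open (img i) by exact: img_open.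
have /nbhs_ballP[e /= e0 eU] : nbhs (coord i x) (img i).
  by apply: open_nbhs_nbhs; split; [|exact: img_coord].
exists (e / 2); first by rewrite divr_gt0.
move=> u /= ur; apply: eU; rewrite -ball_normE /= distrC.
by rewrite (le_lt_trans ur)// ltr_pdivrMr// ltr_pMr// ltr1n.
Qed.

(** The closed ball is compact, hence so is its continuous image, and a compact subset of a
    Hausdorff space is closed. Closedness in all of [M] allows extension by zero. *)
Lemma closed_param_ball i (c : 'rV[R]_n) r :
  [set u | `|u - c| <= r] `<=` img i ->
  closed (param i @` [set u | `|u - c| <= r]).
Proof.
move=> BU; apply: compact_closed => //; apply: continuous_compact.
  apply: continuous_in_subspaceT => u; rewrite inE => /BU; exact: param_cts.
apply: bounded_closed_compact.
  exists (`|c| + r); split; first exact: num_real.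
  move=> s rs u /= uB; apply/ltW/(le_lt_trans _ rs).
  by rewrite -[u](subrK c) addrC (le_trans (ler_normD _ _))// lerD.
have -> : [set u | `|u - c| <= r] =
  (fun u : 'rV[R]_n => `|u - c|) @^-1` [set t | t <= r] by [].
apply: closed_comp; last exact: closed_le.
move=> u _; apply: (@continuous_comp _ _ _ (fun w : 'rV[R]_n => w - c) Num.norm).
  apply: (@continuousB _ _ _ id (cst c)).
    exact: cvg_id.
  exact: cst_continuous.
exact: norm_continuous.
Qed.

(** Extension by zero outside the chart. The bump function enters as a scalar matrix, so that
    smoothness is a case of that of matrix products. *)
Definition cutoff i c r m p (h : M -> 'M[R[i]]_(m, p)) (y : M) : 'M[R[i]]_(m, p) :=
  if `[< dom i y >] then toC (bump_fun c r (coord i y))%:M *m h y else 0.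

Lemma cutoff_smooth i j (c : 'rV[R]_n) r m p (h : M -> 'M[R[i]]_(m, p)) :
  0 < r -> [set u | `|u - c| <= r] `<=` img i ->
  csmooth_on (overlap j i) (h \o param j) ->
  csmooth_on (img j) (cutoff i c r h \o param j).
Proof.
move=> r0 BU sh; apply: csmooth_on_local => u ju.
have [iu|iu] := pselect (dom i (param j u)).
  exists (overlap j i), (fun w =>
    toC (bump_fun c r (coord i (param j w)))%:M *m h (param j w)).
  split; [exact: open_overlap|by apply/overlap_param| |].
    apply: csmooth_on_mulmx => //; first exact: open_overlap.
    apply: csmooth_on_toC => k.
    apply: (Ck_on_comp (U' := setT) (f := coord i \o param j)
      (g := fun v => (bump_fun c r v)%:M)) => //.
    - exact: open_overlap.
    - exact: (transition_smooth j i).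
    - apply: Ck_on_mx; first exact: openT.
      move=> a b; under eq_fun do rewrite mxE.
      case: (a == b); last by under eq_fun do rewrite mulr0n; exact: Ck_on_cst.
      by under eq_fun do rewrite mulr1n; apply: smooth_on_bump; exact: openT.
  by move=> w /overlap_param[_ iw]; rewrite /cutoff /= asboolT.
(* A point outside [dom i] lies off the image of the ball. The complement of that image is open, and
   the cutoff vanishes on it: either the point is outside the chart or the bump function is zero. *)
exists [set w | img j w /\
  (~` (param i @` [set u | `|u - c| <= r])) (param j w)], (fun=> 0).
split.
- by apply: open_img_preimage; rewrite openC; exact: closed_param_ball.
- split=> // -[w wB uw]; apply: iu; rewrite -uw.
  by have [] := img_param (BU _ wB).
- exact: csmooth_on_cst.
move=> w [jw Kw]; rewrite /cutoff /=; case: asboolP => // iw.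
have [->|b0] := eqVneq (bump_fun c r (coord i (param j w))) 0.
  by rewrite /toC map_scalar_mx mul_scalar_mx rmorph0 scale0r.
by case: Kw; exists (coord i (param j w)); [exact: bump_fun_support b0|rewrite coordK].
Qed.

Lemma extend_cvector i x (v : 'rV[R[i]]_n) : dom i x ->
  exists Z : cvector_field A, Z i x = v.
Proof.
move=> ix; have [r r0 BU] := closed_ball_in_img ix.
set c := coord i x in BU.
pose b := real_complex R (bump_fun c r c).
have b0 : b != 0 by rewrite fmorph_eq0 bump_fun_center.
(* This is the constant field [b^-1 *: v] of chart [i], carried to chart [j]. The factor [b^-1]
   compensates the value of the bump function at its centre. *)
pose Z j := cutoff i c r (fun y => b^-1 *: v *m toC (transition_jac i j y)).
have Zchange j k y : dom j y -> dom k y -> Z k y = Z j y *m toC (transition_jac j k y).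
  move=> jy ky; rewrite /Z /cutoff; case: asboolP => [iy|_]; last by rewrite mul0mx.
  by rewrite (transition_jac_comp iy jy ky) /toC map_mxM !mulmxA.
have Zsmooth j : csmooth_on (img j) (Z j \o param j).
  apply: cutoff_smooth => //.
  apply: csmooth_on_mulmx; first exact: open_overlap.
    exact: csmooth_on_cst.
  apply: csmooth_on_toC; exact: smooth_transition_jac_inv.
exists (CVectorField Zchange Zsmooth).
rewrite /= /Z /cutoff asboolT// transition_jac_id// /toC !map_scalar_mx mulmx1.
by rewrite mul_scalar_mx scalerA divff// scale1r.
Qed.

Lemma extend_cone_form i x (a : 'cV[R[i]]_n) : dom i x ->
  exists g : cone_form A, g i x = a.
Proof.
move=> ix; have [r r0 BU] := closed_ball_in_img ix.
set c := coord i x in BU.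
pose b := real_complex R (bump_fun c r c).
have b0 : b != 0 by rewrite fmorph_eq0 bump_fun_center.
pose g j := cutoff i c r (fun y => toC (transition_jac j i y) *m (b^-1 *: a)).
have gchange j k y : dom j y -> dom k y -> g j y = toC (transition_jac j k y) *m g k y.
  move=> jy ky; rewrite /g /cutoff; case: asboolP => [iy|_]; last by rewrite mulmx0.
  rewrite (transition_jac_comp jy ky iy) /toC map_mxM !map_scalar_mx.
  by rewrite !mul_scalar_mx -[RHS]scalemxAr -mulmxA.
have gsmooth j : csmooth_on (img j) (g j \o param j).
  apply: cutoff_smooth => //.
  apply: csmooth_on_mulmx; first exact: open_overlap.
    apply: csmooth_on_toC; exact: smooth_transition_jac.
  exact: csmooth_on_cst.
exists (COneForm gchange gsmooth).
rewrite /= /g /cutoff asboolT// transition_jac_id// /toC !map_scalar_mx mul1mx.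
by rewrite mul_scalar_mx scalerA divff// scale1r.
Qed.

End Extension.

(** * Quadratic polynomials in F, the eigenbundles, and the Lie derivative of forms *)

Section FStructures.
Variables (R : realType) (n : nat) (M : topologicalType).
Variable A : smooth_atlas R n M.
Implicit Types (i j : chart A) (x : M) (F : F_structure A).
Local Notation C := R[i].

(** The first condition on [P] is the transformation rule of an endomorphism field, exactly what
    makes the products vector components again. *)
Lemma cvector_field_mulmx (X : cvector_field A) (P : chart A -> M -> 'M[C]_n) :
  (forall i j x, dom i x -> dom j x ->
    P i x *m toC (transition_jac i j x) = toC (transition_jac i j x) *m P j x) ->
  (forall i, csmooth_on (img i) (P i \o param i)) ->
  exists Z : cvector_field A, forall i x, Z i x = X i x *m P i x.
Proof.
move=> hP sP.
have Zchange i j x : dom i x -> dom j x ->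
    X j x *m P j x = X i x *m P i x *m toC (transition_jac i j x).
  by move=> ix jx; rewrite (vcomp_change X ix jx) -!mulmxA (hP i j).
have Zsmooth i : csmooth_on (img i) ((fun x => X i x *m P i x) \o param i).
  apply: csmooth_on_mulmx; [exact: img_open|exact: vcomp_smooth|exact: sP].
by exists (CVectorField Zchange Zsmooth).
Qed.

Lemma cone_form_mulmx (g : cone_form A) (P : chart A -> M -> 'M[C]_n) :
  (forall i j x, dom i x -> dom j x ->
    P i x *m toC (transition_jac i j x) = toC (transition_jac i j x) *m P j x) ->
  (forall i, csmooth_on (img i) (P i \o param i)) ->
  exists b : cone_form A, forall i x, b i x = P i x *m g i x.
Proof.
move=> hP sP.
have bchange i j x : dom i x -> dom j x ->
    P i x *m g i x = toC (transition_jac i j x) *m (P j x *m g j x).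
  by move=> ix jx; rewrite (fcomp_change g ix jx) !mulmxA (hP i j).
have bsmooth i : csmooth_on (img i) ((fun x => P i x *m g i x) \o param i).
  apply: csmooth_on_mulmx; [exact: img_open|exact: sP|exact: fcomp_smooth].
by exists (COneForm bchange bsmooth).
Qed.

(** The pairs [(a, b)] in use are [(i, 0)], [(0, 1)] and [(-i, 0)]: they give multiples of the
    projections onto $H$, $Q_c$ and the conjugate of $H$. *)
Definition Fquad F (a b : C) i x : 'M[C]_n :=
  toC (F i x) *m toC (F i x) + a *: toC (F i x) + b%:M.

Lemma Fquad_change F a b i j x : dom i x -> dom j x ->
  Fquad F a b i x *m toC (transition_jac i j x) =
  toC (transition_jac i j x) *m Fquad F a b j x.
Proof.
move=> ix jx; have := congr1 (@toC R n n) (Fcomp_change F ix jx).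
rewrite /Fquad /toC !map_mxM -!/(toC _).
move: (toC (transition_jac i j x)) (toC (F i x)) (toC (F j x)) => T G H GT.
rewrite !mulmxDl !mulmxDr scalar_mxC -scalemxAl -scalemxAr GT.
by rewrite -mulmxA GT !mulmxA GT.
Qed.

Lemma Fquad_smooth F a b i : csmooth_on (img i) (Fquad F a b i \o param i).
Proof.
have oU : open (img i) by exact: img_open.
have sF : csmooth_on (img i) (fun u => toC (F i (param i u))).
  apply: csmooth_on_toC; exact: Fcomp_smooth.
apply: csmooth_onD => //; last exact: csmooth_on_cst.
apply: csmooth_onD => //; first exact: csmooth_on_mulmx.
rewrite (_ : (fun u => _) = fun u => a%:M *m toC (F i (param i u))).
  by apply: csmooth_on_mulmx => //; exact: csmooth_on_cst.
by apply/funext => u; rewrite mul_scalar_mx.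
Qed.

Lemma toC_cubic F i x : dom i x ->
  toC (F i x) *m toC (F i x) *m toC (F i x) = - toC (F i x).
Proof.
move=> ix; have := congr1 (@toC R n n) (Fcomp_cubic F ix).
rewrite /toC map_mxD !map_mxM map_mx0 -!/(toC _) => /eqP.
by rewrite addr_eq0 => /eqP.
Qed.

Lemma imagI_sqr : imagI R * imagI R = -1.
Proof. by apply/eqP; rewrite eq_complex /=; apply/andP; split; apply/eqP; ring. Qed.

Lemma sub_bundleH F i x m (v : 'M[C]_(m, n)) :
  reflect (v *m toC (F i x) = imagI R *: v) (v <= bundleH F i x)%MS.
Proof. exact: eigenspaceP. Qed.

Lemma sub_bundleQ F i x m (v : 'M[C]_(m, n)) :
  reflect (v *m toC (F i x) = 0) (v <= bundleQ F i x)%MS.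
Proof. by apply: (iffP eigenspaceP); rewrite scale0r. Qed.

(** From $F^3 = -F$ one gets $(F^2 + iF)F = iF^2 - F = i(F^2 + iF)$. *)
Lemma Fquad_bundleH F i x m (v : 'M[C]_(m, n)) : dom i x ->
  (v *m Fquad F (imagI R) 0 i x <= bundleH F i x)%MS.
Proof.
move=> ix; apply/sub_bundleH; rewrite /Fquad -mulmxA !mulmxDl (toC_cubic F ix).
rewrite raddf0 mul0mx !addr0 -!scalemxAl [RHS]scalemxAr; congr (_ *m _).
by rewrite scalerDr scalerA imagI_sqr scaleN1r addrC.
Qed.

Lemma Fquad_bundleQ F i x m (v : 'M[C]_(m, n)) : dom i x ->
  (v *m Fquad F 0 1 i x <= bundleQ F i x)%MS.
Proof.
move=> ix; apply/sub_bundleQ; rewrite /Fquad -mulmxA !mulmxDl (toC_cubic F ix).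
by rewrite scale0r mul0mx addr0 mul1mx addNr mulmx0.
Qed.

Lemma mul_bundleH_Fquad F a b i x m (v : 'M[C]_(m, n)) :
  (v <= bundleH F i x)%MS ->
  v *m Fquad F a b i x = (-1 + a * imagI R + b) *: v.
Proof.
move=> /sub_bundleH vF; rewrite /Fquad !mulmxDr mulmxA vF -scalemxAl vF scalerA.
by rewrite imagI_sqr -scalemxAr vF scalerA mul_mx_scalar !scalerDl.
Qed.

Lemma mul_bundleQ_Fquad F a b i x m (v : 'M[C]_(m, n)) :
  (v <= bundleQ F i x)%MS -> v *m Fquad F a b i x = b *: v.
Proof.
move=> /sub_bundleQ vF; rewrite /Fquad !mulmxDr mulmxA vF mul0mx -scalemxAr vF.
by rewrite scaler0 !add0r mul_mx_scalar.
Qed.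

Lemma sub_bundle_sum (B D : subbundle A) i x m (v : 'M[C]_(m, n)) :
  (v <= bundle_sum B D i x)%MS ->
  exists b d, [/\ (b <= B i x)%MS, (d <= D i x)%MS & v = b + d].
Proof.
move=> /sub_addsmxP[[u w] /= ->].
by exists (u *m B i x), (w *m D i x); split=> //; exact: submxMl.
Qed.

Lemma sub_bundleHQ F i x (v : 'rV[C]_n) : dom i x ->
  reflect (v *m Fquad F (- imagI R) 0 i x = 0)
    (v <= bundle_sum (bundleH F) (bundleQ F) i x)%MS.
Proof.
move=> ix; apply: (iffP idP) => [/sub_bundle_sum[h [q [hH qQ ->]]]|v0].
  rewrite mulmxDl (mul_bundleH_Fquad _ _ hH) (mul_bundleQ_Fquad _ _ qQ).
  by rewrite mulNr imagI_sqr opprK addNr addr0 !scale0r addr0.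
(* If $vF^2 = i\,vF$, then $v(F^2 + iF) = 2vF^2$, so $-\frac12 v(F^2 + iF) + v(F^2 + 1) = v$; the
   summands lie in $H$ and $Q_c$. *)
have -> : v = ((- 2^-1) *: v) *m Fquad F (imagI R) 0 i x + v *m Fquad F 0 1 i x.
  have : v *m toC (F i x) *m toC (F i x) = imagI R *: (v *m toC (F i x)).
    move: v0; rewrite /Fquad raddf0 addr0 mulmxDr mulmxA -scalemxAr scaleNr => /eqP.
    by rewrite subr_eq0 => /eqP.
  rewrite /Fquad raddf0 addr0 scale0r addr0 !mulmxDr !mulmxA -!scalemxAl -!scalemxAr.
  move=> ->; rewrite mulmx1 -scalerDl -opprD.
  have := splitr (1 : C); rewrite div1r => <-.
  by rewrite scaleN1r addKr.
by apply: addmx_sub_adds; [exact: Fquad_bundleH|exact: Fquad_bundleQ].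
Qed.

(** The pairing of [Z] with [b] vanishes on the whole chart, so its derivative along [X] vanishes
    too; this trades the derivative of [b] for minus that of [Z], and the term with the derivative
    of [X] completes the bracket. *)
Lemma mul_lie_derivative (X Z : cvector_field A) (b : cone_form A) i x :
  (forall y, dom i y -> Z i y *m b i y = 0) -> dom i x ->
  Z i x *m lie_derivative X b i x = - (lie_bracket X Z i x *m b i x).
Proof.
move=> Zb0 ix.
have oU : open (img i) by exact: img_open.
have : cjacobian (fun u => (Z i \o param i) u *m (b i \o param i) u) (coord i x) = 0.
  apply: (cjacobian_eq0 oU) (img_coord ix) => u /img_param[iu _]; exact: Zb0.
rewrite (cjacobian_mulmx (vcomp_smooth Z i) (fcomp_smooth b i) (img_coord ix)).
rewrite /lie_derivative /lie_bracket /= coordK//.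
set JZ := cjacobian (Z i \o param i) _.
set Jb := cjacobian (fun u => (b i (param i u))^T) _.
set JX := cjacobian (X i \o param i) _.
move: (X i x) (Z i x) (b i x) JZ Jb JX => v w c JZ Jb JX J0.
have E : w *m (v *m Jb)^T = - (v *m JZ *m c).
  (* Both sides are scalars, and a matrix of size one equals its transpose. *)
  have T1 (B : 'M[C]_1) : B^T = B by apply/matrixP => a1 a2; rewrite !ord1 mxE.
  rewrite -[LHS]T1 trmx_mul trmxK -!mulmxA (_ : Jb *m w^T = - (JZ *m c)).
    by rewrite mulmxN.
  by apply/eqP; rewrite -addr_eq0 addrC J0.
by rewrite mulmxDr E mulmxBl opprB addrC mulmxA.
Qed.

End FStructures.

(** * Sections of the bundles and the integrability criterion *)

Section Integrability.
Variables (R : realType) (n : nat) (M : topologicalType).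
Hypothesis M_hausdorff : hausdorff_space M.
Variables (A : smooth_atlas R n M) (F : F_structure A).
Local Notation C := R[i].
Local Notation HQ := (bundle_sum (bundleH F) (bundleQ F)).

Lemma extend_bundleH (i : chart A) x (v : 'rV[C]_n) : dom i x ->
  (v <= bundleH F i x)%MS ->
  exists2 Z : cvector_field A, section_of (bundleH F) Z & Z i x = v.
Proof.
(* The factor [- 2^-1] is there because $F^2 + iF$ acts on $H$ as $-2$. *)
move=> ix vH; have [W Wv] := extend_cvector M_hausdorff (- 2^-1 *: v) ix.
have [Z ZE] := cvector_field_mulmx W (@Fquad_change _ _ _ _ F (imagI R) 0)
  (@Fquad_smooth _ _ _ _ F (imagI R) 0).
exists Z; first by move=> j y jy; rewrite ZE; exact: Fquad_bundleH.
have c2 : -1 + imagI R * imagI R + 0 = - 2 :> C by rewrite imagI_sqr addr0 -opprD.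
rewrite ZE Wv -scalemxAl (mul_bundleH_Fquad _ _ vH) c2 scalerA mulrNN.
by rewrite mulVf ?scale1r// pnatr_eq0.
Qed.

Lemma extend_bundleQ (i : chart A) x (v : 'rV[C]_n) : dom i x ->
  (v <= bundleQ F i x)%MS ->
  exists2 Z : cvector_field A, section_of (bundleQ F) Z & Z i x = v.
Proof.
move=> ix vQ; have [W Wv] := extend_cvector M_hausdorff v ix.
have [Z ZE] := cvector_field_mulmx W (@Fquad_change _ _ _ _ F 0 1)
  (@Fquad_smooth _ _ _ _ F 0 1).
exists Z; first by move=> j y jy; rewrite ZE; exact: Fquad_bundleQ.
by rewrite ZE Wv (mul_bundleQ_Fquad _ _ vQ) scale1r.
Qed.

(** Multiplying an extension of [a] by $P = F^2 - iF$ gives a form that kills $H + Q_c$, the kernel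
    of $P$. Pairing a vector with the values $Pa$, for all [a], tests whether it lies in this
    kernel. *)
Lemma extend_annihilator (i : chart A) x (a : 'cV[C]_n) : dom i x ->
  exists2 b : cone_form A, (forall j y, dom j y -> annihilator HQ j y (b j y)) &
    b i x = Fquad F (- imagI R) 0 i x *m a.
Proof.
move=> ix; have [g ga] := extend_cone_form M_hausdorff a ix.
have [b bE] := cone_form_mulmx g (@Fquad_change _ _ _ _ F (- imagI R) 0)
  (@Fquad_smooth _ _ _ _ F (- imagI R) 0).
exists b; last by rewrite bE ga.
by move=> j y jy v /(sub_bundleHQ _ _ jy) v0; rewrite bE mulmxA v0 mul0mx.
Qed.

(** With the zero form below, this provides the sections $(X, 0)$ and $(0, \beta)$ to which
    integrability is applied. *)
Lemma zero_cvector_field : exists Z : cvector_field A, forall i x, Z i x = 0.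
Proof.
suff [h1 h2] : (forall i j x, dom i x -> dom j x ->
    0 = 0 *m toC (transition_jac (A := A) i j x) :> 'rV[C]_n) /\
    (forall i : chart A, csmooth_on (img i) ((fun=> 0 : 'rV[C]_n) \o param i)).
  by exists (CVectorField h1 h2).
by split=> [i j x _ _|i]; [rewrite mul0mx|exact: csmooth_on_cst].
Qed.

Lemma zero_cone_form : exists b : cone_form A, forall i x, b i x = 0.
Proof.
suff [h1 h2] : (forall i j x, dom i x -> dom j x ->
    0 = toC (transition_jac (A := A) i j x) *m 0 :> 'cV[C]_n) /\
    (forall i : chart A, csmooth_on (img i) ((fun=> 0 : 'cV[C]_n) \o param i)).
  by exists (COneForm h1 h2).
by split=> [i j x _ _|i]; [rewrite mulmx0|exact: csmooth_on_cst].
Qed.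

Lemma differential_eq0 (f : chart A -> M -> 'M[C]_1) (i : chart A) x :
  (forall y, dom i y -> f i y = 0) -> dom i x -> differential f i x = 0.
Proof.
move=> f0 ix; apply: (cjacobian_eq0 (@img_open _ _ _ A i) _ (img_coord ix)) => u.
by move=> /img_param[iu _]; exact: f0.
Qed.

Lemma sub_bundleH_HQ (i : chart A) x m (v : 'M[C]_(m, n)) :
  (v <= bundleH F i x)%MS -> (v <= HQ i x)%MS.
Proof. by move=> vH; exact: submx_trans vH (addsmxSl _ _). Qed.

Lemma sub_bundleQ_HQ (i : chart A) x m (v : 'M[C]_(m, n)) :
  (v <= bundleQ F i x)%MS -> (v <= HQ i x)%MS.
Proof. by move=> vQ; exact: submx_trans vQ (addsmxSr _ _). Qed.

(** The value on [v] is computed after extending its $H$ and $Q_c$ parts to sections: each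
    contributes minus the pairing of [b] with a bracket, and that bracket lies in $H + Q_c$. *)
Lemma lie_derivative_annihilator (X : cvector_field A) (b : cone_form A) :
  bracket_sub (bundleH F) (bundleH F) (bundleH F) ->
  bracket_sub (bundleH F) (bundleQ F) HQ ->
  section_of (bundleH F) X ->
  (forall i x, dom i x -> annihilator HQ i x (b i x)) ->
  forall i x, dom i x -> annihilator HQ i x (lie_derivative X b i x).
Proof.
move=> HHH HQHQ XH bHQ i x ix v /sub_bundle_sum[h [q [hH qQ ->]]].
have [Zh ZhH <-] := extend_bundleH ix hH.
have [Zq ZqQ <-] := extend_bundleQ ix qQ.
rewrite mulmxDl !mul_lie_derivative//.
- rewrite (bHQ _ _ ix _ (sub_bundleH_HQ (HHH _ _ XH ZhH _ _ ix))).
  by rewrite (bHQ _ _ ix _ (HQHQ _ _ XH ZqQ _ _ ix)) oppr0 addr0.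
- by move=> y iy; apply: bHQ => //; apply: sub_bundleQ_HQ; exact: ZqQ.
- by move=> y iy; apply: bHQ => //; apply: sub_bundleH_HQ; exact: ZhH.
Qed.

End Integrability.

Theorem proposition3p1 (R : realType) (n : nat) (M : topologicalType)
    (M_hausdorff : hausdorff_space M)
    (M_second_countable : @second_countable M)
    (A : smooth_atlas R n M) (F : F_structure A) :
  courant_integrable (big_isotropic_of F) <->
  (bracket_sub (bundleH F) (bundleH F) (bundleH F) /\
   bracket_sub (bundleH F) (bundleQ F) (bundle_sum (bundleH F) (bundleQ F))).
Proof.
have [Z0 Z0E] := zero_cvector_field A; have [b0 b0E] := zero_cone_form A.
pose HQ := bundle_sum (bundleH F) (bundleQ F).
have ann0 (i : chart A) x : annihilator HQ i x (b0 i x).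
  by move=> v _; rewrite b0E mulmx0.
split=> [EE|[HHH HQHQ]].
  split=> X Y XH YB i x ix.
    (* The first component of the Courant bracket of $(X, 0)$ and $(Y, 0)$ is $[X, Y]$. *)
    have eX : big_section_of (big_isotropic_of F) X b0.
      by move=> j y jy; split=> //; exact: XH.
    have eY : big_section_of (big_isotropic_of F) Y b0.
      by move=> j y jy; split=> //; exact: YB.
    exact: (EE _ _ _ _ eX eY i x ix).1.
  apply/(sub_bundleHQ _ _ ix).
  (* The row $[X, Y]P$ is zero once its product with every column is; the basis columns recover its
     entries. *)
  suff K (a : 'cV_n) : lie_bracket X Y i x *m Fquad F (- imagI R) 0 i x *m a = 0.
    apply/rowP => c.
    have := congr1 (fun B : 'M[R[i]]_1 => B ord0 ord0) (K (delta_mx c ord0)).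
    by rewrite -colE [LHS]mxE [RHS]mxE => ->; rewrite mxE.
  have [b bHQ ba] := extend_annihilator M_hausdorff F a ix.
  have eX : big_section_of (big_isotropic_of F) X b0.
    by move=> j y jy; split=> //; exact: XH.
  have eb : big_section_of (big_isotropic_of F) Z0 b.
    by move=> j y jy; split=> /=; [rewrite Z0E sub0mx|exact: bHQ].
  have YHQ j y : dom j y -> (Y j y <= HQ j y)%MS.
    by move=> jy; apply: sub_bundleQ_HQ; exact: YB.
  (* The form component of the bracket of $(X, 0)$ and $(0, b)$ annihilates $Y$. It reduces to $L_X
     b$, since $b(X)$ vanishes on the chart, and its value on $Y$ is $-b([X, Y])$. *)
  have := (EE _ _ _ _ eX eb i x ix).2 _ (YHQ _ _ ix).
  rewrite /= differential_eq0//; last first.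
    move=> y iy; rewrite /contraction Z0E mul0mx sub0r (bHQ _ _ iy) ?oppr0//.
    by apply: sub_bundleH_HQ; exact: XH.
  rewrite scaler0 addr0 {2}/lie_derivative Z0E mul0mx trmx0 b0E mulmx0 addr0 subr0.
  rewrite mul_lie_derivative//; last by move=> y iy; exact: bHQ (YHQ _ _ iy).
  by rewrite ba mulmxA => /eqP; rewrite oppr_eq0 => /eqP.
move=> X a Y b Xa Yb i x ix; split=> /=.
  by apply: HHH => // j y jy; [have [] := Xa _ _ jy|have [] := Yb _ _ jy].
have XH : section_of (bundleH F) X by move=> j y jy; have [] := Xa _ _ jy.
have YH : section_of (bundleH F) Y by move=> j y jy; have [] := Yb _ _ jy.
have aHQ j y : dom j y -> annihilator HQ j y (a j y).
  by move=> jy; have [] := Xa _ _ jy.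
have bHQ j y : dom j y -> annihilator HQ j y (b j y).
  by move=> jy; have [] := Yb _ _ jy.
(* Both contractions vanish because $X$ and $Y$ lie in $H$ while the forms annihilate $H + Q_c$;
   only the two Lie derivatives remain. *)
rewrite differential_eq0//; last first.
  move=> y iy; rewrite /contraction (aHQ _ _ iy) ?(bHQ _ _ iy) ?subr0//.
    by apply: sub_bundleH_HQ; exact: XH.
  by apply: sub_bundleH_HQ; exact: YH.
move=> v vHQ; rewrite scaler0 addr0 mulmxBr.
rewrite (lie_derivative_annihilator M_hausdorff HHH HQHQ XH bHQ ix vHQ).
by rewrite (lie_derivative_annihilator M_hausdorff HHH HQHQ YH aHQ ix vHQ) subr0.
Qed.
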